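(* Let $\Psi$ be an index function such that $$\frac1\alpha\bigl(T_\alpha(x^\dagger;Ax^\dagger)-T_\alpha(x_\alpha;Ax^\dagger)\bigr)\le\Psi(\alpha)\quad\text{for all }\alpha>0 .$$ Then $$B_{\xi_\alpha^\delta}(x_\alpha^\delta;x^\dagger)\le \frac{\delta^2}{2\alpha}+\Psi(\alpha)\quad\text{for all }\alpha>0 .$$
   Context: Setting. $X$ is an infinite-dimensional Banach space, $H$ an infinite-dimensional Hilbert space with norm $\|\cdot\|$, and $A:X\to H$ a bounded linear operator with non-closed range; $A^*:H\to X^*$ is its adjoint. $J:X\to[0,\infty]$ is a proper convex functional, lower semi-continuous with respect to weak (or weak$^*$) sequential convergence, such that for every $c\ge0$ the sublevel set $\{x\in X: J(x)\le c\}$ is weakly (or weak$^*$) sequentially compact. $y\in \mathrm{range}(A)$, and $Ax=y$ has at least one solution with finite penalty value. $x^\dagger\in X$ denotes a $J$-minimizing solution: $Ax^\dagger=y$ and $J(x^\dagger)=\min\{J(x): x\in X, Ax=y\}<\infty$. The noisy data $y^\delta\in H$ satisfy $\|y^\delta-y\|\le\delta$, with $\delta\ge0$. Tikhonov functional: for $\alpha>0$ and $v\in H$, $T_\alpha(x;v):=\frac12\|Ax-v\|^2+\alpha J(x)$, $x\in X$. For each $\alpha>0$, $x_\alpha$ is an (arbitrarily selected) minimizer of $T_\alpha(\cdot;y)$ over $X$ and $x_\alpha^\delta$ is an (arbitrarily selected) minimizer of $T_\alpha(\cdot;y^\delta)$ over $X$. Bregman distance: for $z\in X$ and $\zeta\in\partial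 J(z)\subset X^*$ (convex subdifferential), $B_\zeta(z;x):=J(x)-J(z)-\langle\zeta,x-z\rangle$, $x\in X$. Convention: $\xi_\alpha^\delta\in\partial J(x_\alpha^\delta)$ is the subgradient satisfying the optimality condition $A^*(Ax_\alpha^\delta-y^\delta)+\alpha\,\xi_\alpha^\delta=0$. An index function is a function $\varphi:(0,\infty)\to(0,\infty)$ that is continuous, strictly increasing and satisfies $\lim_{t\to+0}\varphi(t)=0$. *)

(* Defs.v *)
From mathcomp Require Import all_boot all_order all_algebra.
From mathcomp Require Import sesquilinear.
From mathcomp Require Import all_classical all_reals all_analysis.

Set Implicit Arguments.
Unset Strict Implicit.
Unset Printing Implicit Defensive.

Import Order.TTheory GRing.Theory Num.Theory.
Import numFieldNormedType.Exports.

Local Open Scope classical_set_scope.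
Local Open Scope ring_scope.

Definition infinite_dimensional (R : realType) (V : lmodType R) : Prop :=
  forall (n : nat) (e : 'I_n -> V),
    exists v : V, forall c : 'I_n -> R, v <> \sum_(i < n) c i *: e i.

Definition bounded_operator (R : realType) (V W : normedModType R)
    (f : V -> W) : Prop :=
  exists M : R, forall x : V, `|f x| <= M * `|x|.

(* The norm of the complete normed space H is the one of the inner product. *)
Definition hilbert_norm (R : realType) (H : completeNormedModType R)
    (ip : {dot H for @idfun R}) : Prop :=
  forall u : H, `|u| = Num.sqrt (ip u u).

(* The topological dual, as a subspace of the lmodType X -> R^o; this is where
   addition, scaling and the zero functional are taken. *)
Definition dual_space (R : realType) (X : normedModType R) : set (X -> R^o) :=
  [set f | linear f /\ bounded_operator f].
Arguments dual_space {R} X.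

(* The adjoint H -> X^*, with H identified with its dual via Riesz. *)
Definition adjoint (R : realType) (X H : completeNormedModType R)
    (ip : {dot H for @idfun R}) (A : X -> H) (h : H) : X -> R^o :=
  fun x => ip h (A x).

(* iota identifies X with the dual of Y, isometrically for the dual norm. *)
Definition is_dual_of (R : realType) (X Y : completeNormedModType R)
    (iota : X -> (Y -> R^o)) : Prop :=
  [/\ linear iota,
      range iota = dual_space Y &
      forall x, `|x| = sup [set `|iota x y| | y in [set y : Y | `|y| <= 1]]].

(* Weak convergence, or weak* convergence with respect to a predual of X. *)
Inductive convergence_mode (R : realType) (X : completeNormedModType R) :=
| Weak
| WeakStar (Y : completeNormedModType R) (iota : X -> (Y -> R^o))
    of is_dual_of iota.

Definition seq_cvg_to (R : realType) (X : completeNormedModType R)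
    (m : convergence_mode X) (u : nat -> X) (l : X) : Prop :=
  match m with
  | Weak => forall f, dual_space X f -> f (u n) @[n --> \oo] --> f l
  | WeakStar Y iota _ =>
      forall y : Y, iota (u n) y @[n --> \oo] --> iota l y
  end.

Definition seq_lower_semicontinuous (R : realType)
    (X : completeNormedModType R) (m : convergence_mode X)
    (J : X -> \bar R) : Prop :=
  forall (u : nat -> X) (l : X),
    seq_cvg_to m u l -> (J l <= limn_einf (J \o u))%E.

Definition seq_compact (R : realType) (X : completeNormedModType R)
    (m : convergence_mode X) (S : set X) : Prop :=
  forall u : nat -> X, (forall n, S (u n)) ->
    exists (phi : nat -> nat) (l : X),
      [/\ {homo phi : i j / (i < j)%N}, S l & seq_cvg_to m (u \o phi) l].

Definition proper_functional (R : realType) (X : Type) (J : X -> \bar R) :=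
  exists x, (J x < +oo)%E.

(* The products follow the convention 0 * +oo = 0. *)
Definition convex_functional (R : realType) (X : lmodType R)
    (J : X -> \bar R) : Prop :=
  forall (x y : X) (t : R), 0 <= t <= 1 ->
    (J (t *: x + (1 - t) *: y)%R
       <= t%:E * J x + (1 - t)%:E * J y)%E.

Definition J_minimizing_solution (R : realType) (X H : completeNormedModType R)
    (A : X -> H) (J : X -> \bar R) (y : H) (x : X) : Prop :=
  [/\ A x = y, forall z, A z = y -> (J x <= J z)%E & (J x < +oo)%E].

Definition tikhonov (R : realType) (X H : completeNormedModType R)
    (A : X -> H) (J : X -> \bar R) (alpha : R) (x : X) (v : H) : \bar R :=
  ((2^-1 * `|A x - v| ^+ 2)%:E + alpha%:E * J x)%E.

Definition tikhonov_minimizer (R : realType) (X H : completeNormedModType R)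
    (A : X -> H) (J : X -> \bar R) (alpha : R) (v : H) (x : X) : Prop :=
  forall z : X, (tikhonov A J alpha x v <= tikhonov A J alpha z v)%E.

(* Empty outside the effective domain of J. *)
Definition subdifferential (R : realType) (X : completeNormedModType R)
    (J : X -> \bar R) (z : X) : set (X -> R^o) :=
  [set zeta | [/\ dual_space X zeta, (J z < +oo)%E &
     forall x, (J z + (zeta (x - z)%R)%:E <= J x)%E]].

(* Meant for J z finite, in particular for zeta in subdifferential J z. *)
Definition bregman (R : realType) (X : completeNormedModType R)
    (J : X -> \bar R) (zeta : X -> R^o) (z x : X) : \bar R :=
  (J x - J z - (zeta (x - z)%R)%:E)%E.

(* Only the values on the positive half-line matter. *)
Definition index_function (R : realType) (phi : R -> R) : Prop :=
  [/\ forall t, 0 < t -> 0 < phi t,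
      {within `]0, +oo[, continuous phi},
      {in `]0, +oo[ &, {homo phi : s t / s < t}} &
      phi t @[t --> 0^'+] --> (0 : R)].

(* Main.v *)
(** Pairing the optimality condition with [xdag - z], where [z] is the noisy
    minimizer, and writing [r = A z - ydelta], [d = ydelta - y], gives
    [alpha * B = alpha * (J xdag - J z) - |r|^2 - <r, d>].  Testing the
    minimality of [xa alpha] with [z] bounds [alpha * (J xdag - J z)] by
    [alpha * Psi alpha + |r + d|^2 / 2], and the inner products cancel. *)

Require Import Defs.
From mathcomp Require Import all_boot all_order all_algebra.
From mathcomp Require Import sesquilinear.
From mathcomp Require Import all_classical all_reals all_analysis.
From mathcomp Require Import ring lra.
Import Order.TTheory GRing.Theory Num.Theory.
Import numFieldNormedType.Exports.
Local Open Scope classical_set_scope.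
Local Open Scope ring_scope.

Lemma dot_sqrD (R : realType) (V : lmodType R) (ip : {dot V for @idfun R})
    (u v : V) : ip (u + v) (u + v) = ip u u + 2 * ip u v + ip v v.
Proof.
(* Hermitian symmetry carries the sign $(-1)^0$ and the identity involution, hence is plain
   symmetry. *)
have vu : ip v u = ip u v by rewrite hermC expr0 mul1r.
by rewrite linearDl !linearDr /= vu; ring.
Qed.

Lemma dot_ge0 (R : realType) (V : lmodType R) (ip : {dot V for @idfun R})
    (u : V) : 0 <= ip u u.
Proof.
by have [->|u0] := eqVneq u 0; [rewrite linear0l | exact/ltW/neq0_dnorm_gt0].
Qed.

Theorem mainTheorem2 (R : realType) (X H : completeNormedModType R)
  (hX : infinite_dimensional X) (hH : infinite_dimensional H)
  (ip : {dot H for @idfun R}) (hip : hilbert_norm ip)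
  (A : {linear X -> H}) (hA : bounded_operator A)
  (hrange : ~ closed (range A))
  (mode : convergence_mode X) (J : X -> \bar R)
  (J_ge0 : forall x, (0 <= J x)%E)
  (J_proper : proper_functional J) (J_convex : convex_functional J)
  (J_lsc : seq_lower_semicontinuous mode J)
  (J_compact : forall c : R, 0 <= c ->
     seq_compact mode [set x | (J x <= c%:E)%E])
  (y : H) (hy : range A y)
  (hfin : exists x, A x = y /\ (J x < +oo)%E)
  (xdag : X) (hxdag : J_minimizing_solution A J y xdag)
  (delta : R) (hdelta : 0 <= delta)
  (ydelta : H) (hydelta : `|ydelta - y| <= delta)
  (xa : R -> X)
  (hxa : forall alpha : R, 0 < alpha -> tikhonov_minimizer A J alpha y (xa alpha))
  (xad : R -> X)
  (hxad : forall alpha : R, 0 < alpha ->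
     tikhonov_minimizer A J alpha ydelta (xad alpha))
  (xi : R -> (X -> R^o))
  (hxi : forall alpha : R, 0 < alpha -> subdifferential J (xad alpha) (xi alpha))
  (hopt : forall alpha : R, 0 < alpha ->
     adjoint ip A (A (xad alpha) - ydelta) + alpha *: xi alpha = 0)
  (Psi : R -> R) (hPsi : index_function Psi)
  (hbound : forall alpha : R, 0 < alpha ->
     ((alpha^-1)%:E * (tikhonov A J alpha xdag (A xdag)
                       - tikhonov A J alpha (xa alpha) (A xdag))
        <= (Psi alpha)%:E)%E) :
  forall alpha : R, 0 < alpha ->
    (bregman J (xi alpha) (xad alpha) xdag
       <= (delta ^+ 2 / (2 * alpha) + Psi alpha)%:E)%E.
Proof.
move=> a a0; have [Axdag _ Jxdag] := hxdag; set z := xad a.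
have [_ Jz _] := hxi a a0.
have Jfin x : (J x < +oo)%E -> J x = (fine (J x))%:E.
  by move=> Jx; rewrite fineK// ge0_fin_numE.
have xa_xdag := hxa a a0 xdag; have xa_z := hxa a a0 z.
have := hbound a a0; move: xa_z xa_xdag.
rewrite /bregman /tikhonov Axdag subrr normr0 (Jfin _ Jz) (Jfin _ Jxdag).
set j := fine (J xdag); set jz := fine (J z).
(* [J (xa a)] is a real [t]: [-oo] contradicts nonnegativity, and [+oo] contradicts minimality,
   since competitors with finite penalty exist. *)
have := J_ge0 (xa a); case: (J (xa a)) => [t| |] //= _; last first.
  by rewrite mulry gtr0_sg// mul1e addey.
rewrite -!EFinM -!EFinD !lee_fin => xa_z _ psi.
have sq_norm u : `|u| ^+ 2 = ip u u by rewrite hip sqr_sqrtr// dot_ge0.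
have xiE : a * xi a (xdag - z) = - ip (A z - ydelta) (y - A z).
  (* The optimality condition is an identity of functionals on [X], here evaluated at [xdag - z]. *)
  have opt : ip (A z - ydelta) (A (xdag - z)) + a * xi a (xdag - z) = 0.
    by have /(congr1 (fun f : X -> R^o => f (xdag - z))) := hopt a a0.
  by move/eqP: opt; rewrite addrC addr_eq0 linearB Axdag => /eqP.
set r := A z - ydelta; set d := ydelta - y.
have rd : A z - y = r + d by rewrite /r /d addrA subrK.
have d_le : ip d d <= delta ^+ 2 by rewrite -sq_norm lerXn2r ?nnegrE.
rewrite rd (sq_norm (r + d)) dot_sqrD in xa_z.
have ip_rd : ip r (- (r + d)) = - (ip r r + ip r d).
  by rewrite linearNr linearDr.
rewrite -(opprB (A z)) rd -/r ip_rd opprK in xiE.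
(* After the cancellation a term $-|r|^2/2$ is left over; its sign allows it to be dropped. *)
have r_ge0 := dot_ge0 _ _ ip r.
rewrite mulrC ler_pdivrMr// expr0n mulr0 in psi.
(* A common denominator [a] lets the whole inequality be multiplied by [a]. *)
have -> : delta ^+ 2 / (2 * a) + Psi a = (delta ^+ 2 / 2 + Psi a * a) / a.
  by field; rewrite gt_eqF.
rewrite ler_pdivlMr// mulrC !mulrBr xiE.
(* Adding [psi] and [xa_z] eliminates [a * t] and the residual of [xa a]; with [xiE] the excess over
   [Psi a * a] is at most $(|d|^2 - |r|^2)/2$, and [d_le] concludes. *)
lra.
Qed.
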